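(* Let $K$ and $L$ be compact spaces. Assume there exists a closed linear homeomorphic embedding $T:C_p(K)\to C_p(L)$. If $L$ is $NY$ compact, then $K$ is $NY$ compact as well.
   Context: All topological spaces are Tychonoff (completely regular Hausdorff). $C_p(X)$ is the space of real-valued continuous functions on $X$ with the topology of pointwise convergence. A closed linear homeomorphic embedding is a linear map that is a homeomorphism onto its image, with the image closed in the target. For a family $\{X_\gamma:\gamma\in\Gamma\}$ of nonempty spaces and points $a_\gamma\in X_\gamma$, the $\sigma$-product is $\sigma(X_\gamma,a_\gamma,\Gamma)=\{(x_\gamma)\in\prod_{\gamma\in\Gamma}X_\gamma: |\{\gamma\in\Gamma:x_\gamma\neq a_\gamma\}|<\omega\}$, with the subspace topology from the product. A compact space is $NY$ compact if it is homeomorphic to a subspace of $\sigma(X_\gamma,a_\gamma,\Gamma)$ for some set $\Gamma$, some compact metrizable spaces $X_\gamma$ and some points $a_\gamma\in X_\gamma$. *)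

(* Defs.v *)
From HB Require Import structures.
From mathcomp Require Import all_boot all_order all_algebra.
From mathcomp Require Import all_classical all_reals all_analysis.

Set Implicit Arguments.
Unset Strict Implicit.
Unset Printing Implicit Defensive.

Import Order.TTheory GRing.Theory Num.Theory.
Import numFieldNormedType.Exports.

Local Open Scope classical_set_scope.
Local Open Scope ring_scope.

Definition tychonoff_space (X : topologicalType) : Prop :=
  completely_regular_space X /\ hausdorff_space X.

(* The empty space is allowed. *)
Definition compact_space (X : topologicalType) : Prop :=
  compact [set: X] /\ tychonoff_space X.

Definition homeomorphism (X Y : topologicalType) (f : X -> Y) : Prop :=
  continuous f /\
  exists2 g : Y -> X, continuous g & cancel f g /\ cancel g f.

Definition homeomorphic (X Y : topologicalType) : Prop :=
  exists f : X -> Y, homeomorphism f.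

(* A set coerces to the type [set_type] of its elements, which carries the
   subspace topology. *)
Definition to_range (X Y : Type) (f : X -> Y) (x : X) : range f :=
  SigSub (mem_set (imageT f x)).

Definition closed_homeomorphic_embedding (X Y : topologicalType) (f : X -> Y)
    : Prop :=
  homeomorphism (to_range f) /\ closed (range f).

Definition metrizable (R : realType) (X : topologicalType) : Prop :=
  exists M : metricType R, homeomorphic X M.

(* Initial topology of the inclusion into [X -> R] with its product topology;
   [continuousType X R] itself gets a topology only through the competing
   modules [ArrowAsProduct], [ArrowAsUniformType] and [ArrowAsCompactOpen]. *)
Definition Cp (R : realType) (X : topologicalType) : Type :=
  initial_topology (fun f : continuousType X R => (f : X -> R) : {ptws X -> R}).

Section Cp_lmodule.
Variables (R : realType) (X : topologicalType).

HB.instance Definition _ := Topological.on (Cp R X).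

Definition Cp_fun (f : Cp R X) : X -> R := (f : continuousType X R).

Lemma Cp_fun_continuous (f : Cp R X) : continuous (Cp_fun f).
Proof. exact: (@cts_fun X R (f : continuousType X R)). Qed.

Definition mkCp (f : X -> R) (cf : continuous f) : Cp R X :=
  (mkcts cf : continuousType X R).

Lemma Cp_eq (f g : Cp R X) : Cp_fun f =1 Cp_fun g -> f = g.
Proof. by move=> fg; apply/(@continuousEP X R). Qed.

Lemma Cp_zero_continuous : continuous (fun _ : X => 0 : R).
Proof. exact: cst_continuous. Qed.

Lemma Cp_opp_continuous (f : Cp R X) : continuous (fun x => - Cp_fun f x).
Proof. by move=> x; apply: cvgN; exact: Cp_fun_continuous. Qed.

Lemma Cp_add_continuous (f g : Cp R X) :
  continuous (fun x => Cp_fun f x + Cp_fun g x).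
Proof. by move=> x; apply: cvgD; exact: Cp_fun_continuous. Qed.

Lemma Cp_scale_continuous (c : R) (f : Cp R X) :
  continuous (fun x => c * Cp_fun f x).
Proof. by move=> x; apply: cvgMl_tmp; exact: Cp_fun_continuous. Qed.

Definition Cp_zero := mkCp Cp_zero_continuous.
Definition Cp_opp f := mkCp (@Cp_opp_continuous f).
Definition Cp_add f g := mkCp (@Cp_add_continuous f g).
Definition Cp_scale c f := mkCp (@Cp_scale_continuous c f).

Lemma Cp_addA : associative Cp_add.
Proof. by move=> f g h; apply: Cp_eq => x; exact: addrA. Qed.

Lemma Cp_addC : commutative Cp_add.
Proof. by move=> f g; apply: Cp_eq => x; exact: addrC. Qed.

Lemma Cp_add0 : left_id Cp_zero Cp_add.
Proof. by move=> f; apply: Cp_eq => x; exact: add0r. Qed.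

Lemma Cp_addN : left_inverse Cp_zero Cp_opp Cp_add.
Proof. by move=> f; apply: Cp_eq => x; exact: addNr. Qed.

HB.instance Definition _ :=
  GRing.isZmodule.Build (Cp R X) Cp_addA Cp_addC Cp_add0 Cp_addN.

Lemma Cp_scaleA (a b : R) (f : Cp R X) :
  Cp_scale a (Cp_scale b f) = Cp_scale (a * b) f.
Proof. by apply: Cp_eq => x; exact: mulrA. Qed.

Lemma Cp_scale1 : left_id 1 Cp_scale.
Proof. by move=> f; apply: Cp_eq => x; exact: mul1r. Qed.

Lemma Cp_scaleDr : right_distributive Cp_scale +%R.
Proof. by move=> a f g; apply: Cp_eq => x; exact: mulrDr. Qed.

Lemma Cp_scaleDl (f : Cp R X) :
  {morph Cp_scale^~ f : a b / a + b}.
Proof. by move=> a b; apply: Cp_eq => x; exact: mulrDl. Qed.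

HB.instance Definition _ := GRing.Zmodule_isLmodule.Build R (Cp R X)
  Cp_scaleA Cp_scale1 Cp_scaleDr Cp_scaleDl.

End Cp_lmodule.

Section sigma_product.
Variables (Gamma : Type) (X : Gamma -> topologicalType) (a : forall g, X g).

Definition sigma_product : set (prod_topology X) :=
  [set x | finite_set [set g | x g <> a g]].

End sigma_product.

Definition NY_compact (R : realType) (K : topologicalType) : Prop :=
  compact_space K /\
  exists (Gamma : Type) (X : Gamma -> topologicalType) (a : forall g, X g),
    (forall g, compact_space (X g) /\ metrizable R (X g)) /\
    exists A : set (sigma_product a), homeomorphic K A.

(* Main.v *)
From HB Require Import structures.
Require Import Defs.
From mathcomp Require Import all_boot all_order all_algebra.
From mathcomp Require Import all_classical all_reals all_analysis.
From mathcomp Require Import ring.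

(* Replacing each metrizable factor of a sigma-product by countably many real
   functions, a compact space X is NY iff it carries a point-finite family of
   countable sets of continuous functions that together separate points.

   Let h be such a family on L, indexed by G.  Each evaluation on K has the
   form phi(y,l) : u |-> sum_i l_i T u(y_i).  For a set M of indices closed
   under countably many countable-valued operations (a "model") the map r_M of L
   that keeps the coordinates in M and kills the others is well defined, and
   (y,l) |-> (r_M y,l) preserves both {phi(y,l) = 0} and {phi(y,l) is an
   evaluation}: these sets are closed, and M contains the supports of a set of
   witnesses that is dense for the M-coordinates.  Since T has closed range,
   the first invariance gives T w = T u o r_M for some w; the second gives a
   retraction R_M of K with w = u o R_M.

   If M is countable, R_M(K) has a countable network, hence countably many
   functions separate it.  In general, well-order G and write M as the union of
   an increasing chain of models N_j; the functions f o R_(N_j) - f o R_(N_<j),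
   with f in a family separating R_(N_j)(K), separate R_M(K), and the family
   stays point-finite because the y_i have finite support, so that R_(N_j) x
   differs from R_(N_<j) x for finitely many j only.  Closing N_<j under j and a
   countable set Z amounts to replacing Z by Z + {j}, so the induction is on the
   initial segment with Z arbitrary and no cardinal arithmetic is needed. *)

Set Implicit Arguments.
Unset Strict Implicit.
Unset Printing Implicit Defensive.

Import Order.TTheory GRing.Theory Num.Theory.
Import numFieldNormedType.Exports.

Local Open Scope classical_set_scope.
Local Open Scope ring_scope.

(** * Ultrafilters on compact spaces *)

Lemma ultra_fmap (S S' : Type) (f : S -> S') (U : set_system S) :
  UltraFilter U -> UltraFilter (f @ U).
Proof.
move=> UU; split=> [|G GF UG]; first exact: fmap_proper_filter.
apply/seteqP; split=> A; last exact: UG.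
move=> GA; have [//|UnA] := in_ultra_setVsetC (f @^-1` A) UU.
have GnA : G (~` A) by apply: UG.
by have /filter_ex [? []] : G (A `&` ~` A) by exact: filterI.
Qed.

Lemma ultra_compact_cvg (X : topologicalType) (S : Type) (f : S -> X)
    (U : set_system S) :
  compact [set: X] -> UltraFilter U -> exists x : X, f s @[s --> U] --> x.
Proof.
rewrite compact_ultra => cX UU.
have [|x [_ fx]] := cX (f @ U) (ultra_fmap f UU); first exact: filterT.
by exists x.
Qed.

(** The closed graph theorem for a compact codomain. If [f] failed to be continuous at [x], some
    ultrafilter converging to [x] would have an image avoiding a neighbourhood [A] of [f x]; the
    image has a limit by compactness, and the graph condition makes it [f x]. *)
Lemma ultra_continuous (X Y : topologicalType) (f : X -> Y) :
  compact [set: Y] ->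
  (forall (x : X) (U : set_system X) (y : Y), UltraFilter U -> U --> x ->
     f z @[z --> U] --> y -> y = f x) ->
  continuous f.
Proof.
move=> cY fP x A Afx; apply: contrapT => nA.
have PF : ProperFilter (within (~` (f @^-1` A)) (nbhs x)).
  apply: Build_ProperFilter_ex => B; rewrite /within /= => nB.
  apply: contrapT => B0; apply: nA.
  apply: filterS nB => z nBz; apply: contrapT => nAz; apply: B0.
  by exists z; exact: nBz.
have [U [UU sU]] := ultraFilterLemma PF.
have Ux : U --> x.
  by move=> B xB; apply: sU; rewrite /within /=; apply: filterS xB => z.
have UnA : U (~` (f @^-1` A)).
  by apply: sU; rewrite /within /=; apply: filterE.
have [y fy] := ultra_compact_cvg f cY UU.
have yfx := fP _ _ _ UU Ux fy; rewrite yfx in fy.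
have UA : U (f @^-1` A) by exact: fy.
by have /filter_ex [? []] : U (f @^-1` A `&` ~` (f @^-1` A)) by exact: filterI.
Qed.

Lemma cvg_lim_uniq (R : realType) (S : Type) (U : set_system S) (f : S -> R)
    (a b : R) : ProperFilter U ->
  f s @[s --> U] --> a -> f s @[s --> U] --> b -> a = b.
Proof. by move=> PU fa fb; exact: cvg_unique (@Rhausdorff R) _ _ _ _ fa fb. Qed.

(** * Function spaces *)

Section Cp_separation.
Variables (R : realType) (X : topologicalType) (tX : tychonoff_space X).

Lemma Cp_separates (x y : X) : x <> y ->
  exists u : Cp R X, Cp_fun u x <> Cp_fun u y.
Proof.
move=> xy; case: tX => cr hX.
have cy : closed [set y].
  by apply: accessible_closed_set1; exact: hausdorff_accessible.
have [f [cf _ f0 f1]] := (@uniform_separatorP X R [set x] [set y]).1 (cr x _ cy xy).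
exists (mkCp cf); change (f x <> f y).
have -> : f x = 0 by apply: f0; exists x.
have -> : f y = 1 by apply: f1; exists y.
by apply/eqP; rewrite eq_sym oner_eq0.
Qed.

Lemma Cp_inj (x y : X) :
  (forall u : Cp R X, Cp_fun u x = Cp_fun u y) -> x = y.
Proof.
move=> h; apply: contrapT => /Cp_separates [u]; exact.
Qed.

End Cp_separation.

(** Induction on [n]. If [phi ord_max] is nonzero at some [v0] killed by the other functionals,
    subtracting [c * phi ord_max] from [psi] leaves a functional that vanishes on their common
    kernel. Otherwise [phi ord_max] vanishes on that kernel too and gets coefficient 0. *)
Lemma functional_span (R : fieldType) (V : lmodType R) (n : nat)
    (phi : 'I_n -> V -> R) (psi : V -> R) :
  (forall i a u v, phi i (a *: u + v) = a * phi i u + phi i v) ->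
  (forall a u v, psi (a *: u + v) = a * psi u + psi v) ->
  (forall v, (forall i, phi i v = 0) -> psi v = 0) ->
  exists l : 'I_n -> R, forall v, psi v = \sum_(i < n) l i * phi i v.
Proof.
elim: n phi psi => [|n IH] phi psi linphi linpsi ker.
  by exists (fun=> 0) => v; rewrite big_ord0; apply: ker => -[].
pose phi' i := phi (widen_ord (leqnSn n) i).
have ordP v : (forall i, phi' i v = 0) -> phi ord_max v = 0 ->
    forall i, phi i v = 0.
  move=> h hmax i; have [->//|ni] := eqVneq i ord_max.
  have lin : (i < n)%N by rewrite ltn_neqAle -ltnS ltn_ord andbT.
  by rewrite -(h (Ordinal lin)) /phi'; congr (phi _ v); exact: val_inj.
have [ [v0 [v00 v0n]]|nv0] :=
    pselect (exists v0, (forall i, phi' i v0 = 0) /\ phi ord_max v0 <> 0).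
  move/eqP in v0n; pose c := psi v0 / phi ord_max v0.
  have [a u v|a u v|v hv|l hl] := IH phi' (fun v => - c * phi ord_max v + psi v).
  - exact: linphi.
  - by rewrite linphi linpsi mulrDr mulrDr mulrCA addrACA.
  (* This multiple of [v0] moves [v] into the kernel of [phi ord_max] as well. *)
  - have := ker ((- (phi ord_max v / phi ord_max v0)) *: v0 + v) _.
    rewrite linpsi /c => h; rewrite -[RHS]h.
      by congr (_ + _); rewrite !mulNr mulrAC [in RHS]mulrAC (mulrC (psi v0)).
    apply: ordP => [i|].
      by rewrite /phi' linphi -/(phi' i v0) -/(phi' i v) v00 mulr0 add0r hv.
    by rewrite linphi mulNr mulfVK// addNr.
  exists (fun i => oapp l c (unlift ord_max i)) => v.
  rewrite big_ord_recr/= unlift_none/=.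
  under eq_bigr => i _.
    rewrite (_ : widen_ord _ i = lift ord_max i); last first.
      by apply: val_inj; rewrite /= /bump leqNgt ltn_ord.
    rewrite liftK/= (_ : lift ord_max i = widen_ord (leqnSn n) i); last first.
      by apply: val_inj; rewrite /= /bump leqNgt ltn_ord.
    over.
  by rewrite -hl addrAC mulNr addNr add0r.
have [a u v|a u v|v hv|l hl] := IH phi' psi.
- exact: linphi.
- exact: linpsi.
- apply: ker; apply: ordP => //; apply: contrapT => hn; apply: nv0.
  by exists v.
exists (fun i => oapp l 0 (unlift ord_max i)) => v.
rewrite big_ord_recr/= unlift_none/= mul0r addr0 hl; apply: eq_bigr => i _.
rewrite (_ : widen_ord _ i = lift ord_max i) ?liftK//=.
  by congr (_ * phi _ v); apply: val_inj; rewrite /= /bump leqNgt ltn_ord.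
by apply: val_inj; rewrite /= /bump leqNgt ltn_ord.
Qed.

Section Cp_topology.
Variables (R : realType) (X : topologicalType).

Lemma Cp_nbhs (v : Cp R X) (A : set (Cp R X)) : nbhs v A ->
  exists n (y : 'I_n -> X) (e : R), 0 < e /\
    forall w, (forall i, `|Cp_fun w (y i) - Cp_fun v (y i)| < e) -> A w.
Proof.
rewrite nbhsE => -[B [ [V oV VB] Bv] BA].
have Vv : nbhs (Cp_fun v : {ptws X -> R}) V.
  by apply: open_nbhs_nbhs; split => //; move: Bv; rewrite -VB.
(* The basic sets around [v] generate a filter converging pointwise to [v], so [V] contains one of
   them. *)
pose B' (p : seq X * R) :=
  [set w : {ptws X -> R} | forall y, y \in p.1 -> `|w y - Cp_fun v y| < p.2].
pose F := filter_from [set p : seq X * R | 0 < p.2] B'.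
have FF : Filter F.
  apply: filter_from_filter; first by exists ([::], 1); exact: ltr01.
  move=> [E1 e1] [E2 e2] /= e10 e20.
  exists (E1 ++ E2, Num.min e1 e2); first by rewrite /= lt_min e10 e20.
  move=> w wE; split=> y /= yE; have := wE y; rewrite /= mem_cat yE ?orbT;
    by move=> /(_ isT); rewrite lt_min => /andP[].
have Fv : F --> (Cp_fun v : {ptws X -> R}).
  apply/pointwise_cvgP => t; apply/cvgrPdist_lt => e e0.
  exists ([:: t], e) => // w /(_ t); rewrite inE eqxx distrC; exact.
have [ [E e] /= e0 EV] := Fv _ Vv.
exists (size E), (tnth (in_tuple E)), e; split=> // w wE; apply: BA.
rewrite -VB; apply: EV => y /(tnthP (in_tuple E)) [i ->]; exact: wE.
Qed.

Lemma Cp_eval_continuous (x : X) : continuous (fun u : Cp R X => Cp_fun u x).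
Proof.
move=> u; apply: (@continuous_comp (Cp R X) {ptws X -> R} R
  (fun u : Cp R X => (Cp_fun u : {ptws X -> R})) (fun f => f x)).
  exact: initial_continuous.
exact: (@proj_continuous X (fun=> R) x).
Qed.

End Cp_topology.

(** * Duality consequences of a closed linear embedding *)

Section embedding.
Variables (R : realType) (K L : topologicalType).
Variables (T : {linear Cp R K -> Cp R L}).
Hypothesis hT : closed_homeomorphic_embedding T.

Let Tfun_lin (a : R) (u v : Cp R K) y :
  Cp_fun (T (a *: u + v)) y = a * Cp_fun (T u) y + Cp_fun (T v) y.
Proof. by rewrite linearP. Qed.

(** Continuity of the inverse of [T] at 0 bounds [u x] by 1 once [T u] is small at finitely many
    points. If [T u] vanishes there, so does [T] of every multiple of [u], which forces [u x = 0];
    then [functional_span] applies. *)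
Lemma embedding_eval_span (x : K) :
  exists n (y : 'I_n -> L) (l : 'I_n -> R),
    forall u, Cp_fun u x = \sum_(i < n) l i * Cp_fun (T u) (y i).
Proof.
have [ [_ [g cg [gK _]]] _] := hT.
have n0 : nbhs (g (to_range T 0)) [set u | `|Cp_fun u x| < 1].
  rewrite gK; have := @Cp_eval_continuous R K x 0.
  move=> /cvgr_dist_lt /(_ 1 ltr01) /=; apply: filterS => u.
  by rewrite sub0r normrN.
have := cg _ _ n0; rewrite nbhsE => -[B [ [V oV VB] B0] BA].
have V0 : nbhs (T 0) V.
  by apply: open_nbhs_nbhs; split => //; move: B0; rewrite -VB.
rewrite linear0 in V0.
have [n [y [e [e0 yV]]]] := Cp_nbhs V0.
exists n, y; apply: functional_span.
- by move=> i a u v; exact: Tfun_lin.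
- by [].
- move=> u Tu0; apply: contrapT => /eqP ux0.
  pose u' := (Cp_fun u x)^-1 *: u.
  have Tu'0 i : Cp_fun (T u') (y i) = 0.
    by rewrite -[u']addr0 Tfun_lin Tu0 linear0 mulr0 add0r.
  have : [set u | `|Cp_fun u x| < 1] (g (to_range T u')).
    apply: BA; rewrite -VB; apply: yV => i /=.
    by rewrite Tu'0 sub0r normrN normr0.
  rewrite /= gK /u' (_ : Cp_fun _ x = 1) ?normr1 ?ltxx//.
  exact: mulVf.
Qed.

(* If the values of [v] at some [y_i] are not those of any [T u], then
   [(u, t) |-> t] vanishes wherever all [(u, t) |-> T u (y_i) - t * v (y_i)] do,
   so it is a linear combination of them. *)
Lemma closed_range_orthogonal (v : Cp R L) :
  (forall n (y : 'I_n -> L) (l : 'I_n -> R),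
    (forall u, \sum_(i < n) l i * Cp_fun (T u) (y i) = 0) ->
    \sum_(i < n) l i * Cp_fun v (y i) = 0) ->
  exists w, T w = v.
Proof.
move=> orth; apply: contrapT => nTv; have [_ cT] := hT.
have nv : nbhs v (~` range T).
  apply: open_nbhs_nbhs; split; first by rewrite openC.
  by move=> [w _ wv]; apply: nTv; exists w.
have [n [y [e [e0 yP]]]] := Cp_nbhs nv.
pose phi (i : 'I_n) (p : Cp R K * R^o) :=
  Cp_fun (T p.1) (y i) - p.2 * Cp_fun v (y i).
have [i a p q|//|[u t] ut|l hl] :=
    @functional_span R (Cp R K * R^o)%type n phi (fun p => p.2).
- by rewrite /phi/= Tfun_lin /GRing.scale /=; ring.
- apply: contrapT => /eqP /= t0.
  apply: (yP (T (t^-1 *: u))); last by exists (t^-1 *: u).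
  move=> i; have := ut i; rewrite /phi /= => /eqP; rewrite subr_eq0 => /eqP h.
  by rewrite -[_ *: u]addr0 Tfun_lin h linear0 addr0 mulKf// subrr normr0.
have /orth : forall u, \sum_(i < n) l i * Cp_fun (T u) (y i) = 0.
  move=> u; have /= {2}-> := hl (u, 0); apply: eq_bigr => i _.
  by rewrite /phi /= mul0r subr0.
move=> v0; have /= := hl (0, 1).
rewrite (eq_bigr (fun i => - (l i * Cp_fun v (y i)))) => [|i _]; last first.
  by rewrite /phi/= linear0 mul1r sub0r mulrN.
by rewrite sumrN v0 oppr0 => /eqP; rewrite oner_eq0.
Qed.

End embedding.

(** * Models and retractions *)

Lemma floor_eq_dist (R : realType) (x y : R) k :
  Num.floor (x * k.+1%:R) = Num.floor (y * k.+1%:R) -> `|x - y| < k.+1%:R^-1.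
Proof.
move=> xy; have k0 : 0 < k.+1%:R :> R by [].
rewrite -(@ltr_pM2r _ k.+1%:R)// mulVf ?lt0r_neq0// -[X in _ * X](gtr0_norm k0).
rewrite -normrM mulrBl.
have /andP[x1 x2] := floor_itv (x * k.+1%:R).
have /andP[y1 y2] := floor_itv (y * k.+1%:R).
rewrite xy in x1 x2; move: x1 x2 y1 y2; rewrite intrD.
move: (x * _) (y * _) (_%:~R) => a b c ? ? ? ?.
rewrite ltr_norml; apply/andP; split.
  rewrite ltrBrDr addrC ltrBlDr; apply: lt_le_trans; first eassumption.
  by rewrite lerD2r.
rewrite ltrBlDr; apply: lt_le_trans; first eassumption.
by rewrite addrC lerD2l.
Qed.

Section model.
Variables (R : realType) (K L : topologicalType).
Variable T : {linear Cp R K -> Cp R L}.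
Hypotheses (cK : compact [set: K]) (tK : tychonoff_space K).
Hypothesis cL : compact [set: L].
Hypothesis eval_span : forall x : K,
  exists n (y : 'I_n -> L) (l : 'I_n -> R),
    forall u, Cp_fun u x = \sum_(i < n) l i * Cp_fun (T u) (y i).
Hypothesis range_orthogonal : forall v : Cp R L,
  (forall n (y : 'I_n -> L) (l : 'I_n -> R),
    (forall u, \sum_(i < n) l i * Cp_fun (T u) (y i) = 0) ->
    \sum_(i < n) l i * Cp_fun v (y i) = 0) ->
  exists w, T w = v.
Variables (G : choiceType) (h : G -> nat -> Cp R L).

Definition supp (y : L) : set G := [set g | exists m, Cp_fun (h g m) y <> 0].

Hypothesis h_sep : forall y y' : L,
  (forall g m, Cp_fun (h g m) y = Cp_fun (h g m) y') -> y = y'.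
Hypothesis h_fin : forall y, finite_set (supp y).

(* [proj_rel M y y'] is [y' = r_M y]; the projection [r_M] is total only when
   [M] is a model. *)
Definition proj_rel (M : set G) (y y' : L) :=
  (forall g m, M g -> Cp_fun (h g m) y' = Cp_fun (h g m) y) /\ supp y' `<=` M.

Lemma proj_rel_off M y y' g m : proj_rel M y y' -> ~ M g ->
  Cp_fun (h g m) y' = 0.
Proof. by move=> [_ s] nM; apply: contrapT => h0; apply/nM/s; exists m. Qed.

Lemma proj_rel_uniq M y y1 y2 : proj_rel M y y1 -> proj_rel M y y2 -> y1 = y2.
Proof.
move=> p1 p2; apply: h_sep => g m; have [Mg|nMg] := pselect (M g).
  by rewrite p1.1// p2.1.
by rewrite (proj_rel_off _ p1)// (proj_rel_off _ p2).
Qed.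

Lemma proj_rel_self M y : supp y `<=` M -> proj_rel M y y.
Proof. by []. Qed.

Definition state n := (('I_n -> L) * ('I_n -> R))%type.

Definition phi n (s : state n) (u : Cp R K) : R :=
  \sum_(i < n) s.2 i * Cp_fun (T u) (s.1 i).

Lemma phi_cvg n (U : set_system (state n)) (y : 'I_n -> L) (l : 'I_n -> R) u :
  Filter U ->
  (forall i, s.1 i @[s --> U] --> y i) -> (forall i, s.2 i @[s --> U] --> l i) ->
  phi s u @[s --> U] --> phi (y, l) u.
Proof.
move=> FU hy hl; rewrite /phi /=.
apply: cvg_big => [|i _]; first exact: add_continuous.
apply: cvgM; first exact: hl.
apply: (@cvg_comp _ _ _ (fun s : state n => s.1 i) (Cp_fun (T u)) _ (nbhs (y i))).
  exact: hy.
exact: Cp_fun_continuous.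
Qed.

Definition supported M n (s : state n) := forall i, supp (s.1 i) `<=` M.

(** An ultrafilter refining the approximations converges by compactness of [L]. In the limit the
    coordinates in [M] are those of [s0], and the others are 0 because every approximant is
    supported in [M]; so the limit points are the projections of those of [s0]. *)
Lemma limit_state n (M : set G) (B : set (state n)) (s0 : state n) :
  (forall (E : seq (G * nat)) k, (forall p, p \in E -> M p.1) ->
    exists s, [/\ B s, supported M s,
      (forall i, `|s.2 i - s0.2 i| < k.+1%:R^-1) &
      forall i p, p \in E -> `|Cp_fun (h p.1 p.2) (s.1 i)
         - Cp_fun (h p.1 p.2) (s0.1 i)| < k.+1%:R^-1]) ->
  exists (U : set_system (state n)) (y' : 'I_n -> L),
    [/\ UltraFilter U, U B, (forall i, s.1 i @[s --> U] --> y' i),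
       (forall i, s.2 i @[s --> U] --> s0.2 i) &
       forall i, proj_rel M (s0.1 i) (y' i)].
Proof.
move=> approx.
pose D := [set p : seq (G * nat) * nat | forall q, q \in p.1 -> M q.1].
pose C (p : seq (G * nat) * nat) := [set s : state n | [/\ B s, supported M s,
      (forall i, `|s.2 i - s0.2 i| < p.2.+1%:R^-1) &
      forall i q, q \in p.1 -> `|Cp_fun (h q.1 q.2) (s.1 i)
         - Cp_fun (h q.1 q.2) (s0.1 i)| < p.2.+1%:R^-1]].
have le_inv (a b c : nat) (x : R) : (a <= b)%N -> x < b.+1%:R^-1 -> x < a.+1%:R^-1.
  by move=> ab /lt_le_trans; apply; rewrite lef_pV2 ?posrE// ler_nat.
have PF : ProperFilter (filter_from D C).
  apply: filter_from_proper; last first.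
    by move=> [E k] DE; have [s] := approx E k DE; exists s.
  apply: filter_from_filter; first by exists ([::], 0).
  move=> [E1 k1] [E2 k2] /= D1 D2; exists (E1 ++ E2, maxn k1 k2).
    by move=> q /=; rewrite mem_cat => /orP[/D1|/D2].
  move=> s [/= Bs Ms sl sy]; split; split=> //=.
  - by move=> i; apply: le_inv (sl i) => //; rewrite leq_maxl.
  - move=> i q qE; have := sy i q; rewrite mem_cat qE => /(_ isT).
    by apply: le_inv => //; rewrite leq_maxl.
  - by move=> i; apply: le_inv (sl i) => //; rewrite leq_maxr.
  - move=> i q qE; have := sy i q; rewrite mem_cat qE orbT => /(_ isT).
    by apply: le_inv => //; rewrite leq_maxr.
have [U [UU FU]] := ultraFilterLemma PF.
have UC E k : D (E, k) -> U (C (E, k)) by move=> DE; apply: FU; exists (E, k).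
have cy i : exists y : L, s.1 i @[s --> U] --> y.
  exact: ultra_compact_cvg.
pose y' i := projT1 (cid (cy i)).
have hy i : s.1 i @[s --> U] --> y' i by rewrite /y'; case: cid.
have D0 k : D ([::], k) by [].
have hyc i g m : Cp_fun (h g m) (s.1 i) @[s --> U] --> Cp_fun (h g m) (y' i).
  apply: (@cvg_comp _ _ _ (fun s : state n => s.1 i) (Cp_fun (h g m)) _
    (nbhs (y' i))).
    exact: hy.
  exact: Cp_fun_continuous.
have inv_lt (e : R) : 0 < e -> exists k, k.+1%:R^-1 < e.
  by move=> /ltr_add_invr [k]; rewrite add0r; exists k.
exists U, y'; split=> //.
- by apply: filterS (UC [::] 0 (D0 0)) => s [].
- move=> i; apply/cvgrPdist_lt => e /inv_lt [k ke].
  apply: filterS (UC [::] k (D0 k)) => s [_ _ /(_ i) sl _].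
  by rewrite distrC; exact: lt_trans ke.
move=> i; split.
- move=> g m Mg; apply: (cvg_lim_uniq _ (hyc i g m)).
  apply/cvgrPdist_lt => e /inv_lt [k ke].
  have /UC : D ([:: (g, m)], k) by move=> q; rewrite inE => /eqP ->.
  apply: filterS => s [_ _ _ /(_ i (g, m))]; rewrite inE eqxx => /(_ isT) /=.
  by rewrite distrC => /lt_trans; exact.
- move=> g [m]; apply: contra_notP => nMg.
  apply: (cvg_lim_uniq _ (hyc i g m)).
  apply: (@cvg_trans _ ((fun=> (0 : R)) @ U)); last exact: cvg_cst.
  apply: near_eq_cvg; apply: filterS (UC [::] 0 (D0 0)) => s [_ sM _ _].
  by apply: contrapT => h0; apply/nMg/(sM i); exists m => // /esym.
Qed.

(** Elements of [G] are named by their position in a partial enumeration [e], which keeps the index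
    type countable for any [G]. [None] selects a coefficient of the state. *)
Definition coord_index n := ('I_n * option (nat * nat))%type.

Definition coord n (e : nat -> option G) (q : coord_index n) (s : state n) : R :=
  match q.2 with
  | None => s.2 q.1
  | Some (a, m) => if e a is Some g then Cp_fun (h g m) (s.1 q.1) else 0
  end.

Definition code n := (nat * seq (coord_index n) * seq int)%type.
HB.instance Definition _ n := Countable.on (code n).

(* Codes live in a countable type and determine the listed coordinates up to
   [1 / (k + 1)], so one witness per code is dense for finitely many indices. *)
Definition has_code n (e : nat -> option G) (s : state n) (d : code n) :=
  [seq Num.floor (coord e q s * d.1.1.+1%:R) | q <- d.1.2] = d.2.

Lemma has_code_close n e (s s' : state n) d q : has_code e s d -> has_code e s' d ->
  q \in d.1.2 -> `|coord e q s - coord e q s'| < d.1.1.+1%:R^-1.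
Proof.
rewrite /has_code => <- /esym /eq_in_map ss' /ss'; exact: floor_eq_dist.
Qed.

(** The two properties of functionals that projections must preserve, merged so that one notion of
    witness serves both. *)
Definition zero_or_eval (b : bool) (f : Cp R K -> R) : Prop :=
  if b then exists x, forall u, f u = Cp_fun u x else forall u, f u = 0.

Lemma zero_or_eval_limit b (S : Type) (U : set_system S) (F : S -> Cp R K -> R) f :
  UltraFilter U -> U [set s | zero_or_eval b (F s)] ->
  (forall u, F s u @[s --> U] --> f u) -> zero_or_eval b f.
Proof.
move=> UU UW Ff; case: b UW => /= UW; last first.
  move=> u; apply: cvg_lim_uniq (Ff u) _.
  apply: (@cvg_trans _ ((fun=> (0 : R)) @ U)); last exact: cvg_cst.
  by apply: near_eq_cvg; apply: filterS UW => s.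
have [s0 [x0 _]] := filter_ex UW.
(* The default [x0] matters only off a set of [U]; on that set [F s] is evaluation at [xs s], and
   compactness of [K] gives these points a limit. *)
pose xs s := xget x0 [set x | forall u, F s u = Cp_fun u x].
have [x xsx] := ultra_compact_cvg xs cK UU.
exists x => u; apply: cvg_lim_uniq (Ff u) _.
apply: (@cvg_trans _ (Cp_fun u (xs s) @[s --> U])).
  apply: near_eq_cvg; apply: filterS UW => s /= ex.
  by have := xgetPex x0 ex => ->.
apply: (@cvg_comp _ _ _ xs (Cp_fun u) _ (nbhs x)) => //.
exact: Cp_fun_continuous.
Qed.

Definition witness b n (F : seq G) (d : code n) : option (state n) :=
  if pselect (exists s, zero_or_eval b (phi s) /\ has_code (onth F) s d) is left ex
  then Some (projT1 (cid ex)) else None.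

Lemma witnessP b n F (d : code n) s :
  zero_or_eval b (phi s) -> has_code (onth F) s d ->
  exists s', [/\ witness b F d = Some s', zero_or_eval b (phi s') &
    has_code (onth F) s' d].
Proof.
move=> Ws cs; rewrite /witness; case: pselect => [ex|[]]; last by exists s.
by exists (projT1 (cid ex)); case: cid => s' [].
Qed.

Definition witness_support (F : seq G) : set G :=
  [set g | exists b n (d : code n) s i, witness b F d = Some s /\ supp (s.1 i) g].

(** Finite lists [F] suffice because a basic neighbourhood tests only finitely many coordinates. *)
Definition model (M : set G) :=
  forall F : seq G, (forall g, g \in F -> M g) -> witness_support F `<=` M.

(** For finitely many coordinates in [M] and a given precision, the witness sharing the code of [s]
    is close to [s], has the same property, and is supported in [M]. Such witnesses converge to the
    projection of [s], and the property passes to limits. *)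
Lemma model_invariant M b n (s : state n) : model M -> zero_or_eval b (phi s) ->
  exists y', (forall i, proj_rel M (s.1 i) (y' i)) /\ zero_or_eval b (phi (y', s.2)).
Proof.
move=> MM Ws.
have [E k EM|U [y' [UU UB Uy Ul py']]] :=
    @limit_state n M [set s | zero_or_eval b (phi s)] s.
  pose F := [seq p.1 | p <- E].
  (* The code records every coefficient and every coordinate tested by [E]; [index p.1 F] is a
     position where [onth F] finds [p.1]. *)
  pose qs : seq (coord_index n) := [seq (i, None) | i <- enum 'I_n] ++
    [seq (i, Some (index p.1 F, p.2)) | i <- enum 'I_n, p <- E].
  pose d : code n :=
    (k, qs, [seq Num.floor (coord (onth F) q s * k.+1%:R) | q <- qs]).
  have [s' [ws' Ws' cs']] := witnessP Ws (erefl : has_code (onth F) s d).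
  exists s'; split=> //.
  - move=> i g sg; apply: (MM F); last by exists b, n, d, s', i.
    by move=> g' /mapP [p /EM Mp ->].
  - move=> i; apply: (has_code_close (q := (i, None)) cs' erefl).
    by rewrite /= mem_cat map_f ?mem_enum.
  - move=> i p pE; have pF : p.1 \in F by exact: map_f.
    have := has_code_close (q := (i, Some (index p.1 F, p.2))) cs'
      (erefl : has_code (onth F) s d).
    rewrite /coord /= onthE (nth_map p.1) ?index_mem// nth_index//; apply.
    by rewrite mem_cat; apply/orP; right; apply: allpairs_f; rewrite ?mem_enum.
exists y'; split=> //; apply: (zero_or_eval_limit UU UB) => u.
exact: phi_cvg.
Qed.

Lemma proj_rel_exists M y : model M -> exists y', proj_rel M y y'.
Proof.
(* With coefficient 0 the functional vanishes whatever the point, so invariance applies to an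
   arbitrary [y]. *)
move=> MM; pose s : state 1 := (fun=> y, fun=> 0).
have [u|y' [py' _]] := @model_invariant M false 1 s MM _.
  by rewrite /phi big1// => i _; rewrite mul0r.
by exists (y' ord0); exact: (py' ord0).
Qed.

(** Each coordinate of [r y] is either the same coordinate of [y] or constantly 0, and the
    coordinates separate points. *)
Lemma proj_rel_continuous M (r : L -> L) :
  (forall y, proj_rel M y (r y)) -> continuous r.
Proof.
move=> rM; apply: ultra_continuous cL _ => y U z UU Uy Uz.
apply: h_sep => g m.
have hz : Cp_fun (h g m) (r y) @[y --> U] --> Cp_fun (h g m) z.
  apply: (@cvg_comp _ _ _ r (Cp_fun (h g m)) _ (nbhs z)) => //.
  exact: Cp_fun_continuous.
apply: (cvg_lim_uniq _ hz); have [Mg|nMg] := pselect (M g).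
  rewrite (rM y).1//; under eq_cvg do rewrite (rM _).1//.
  apply: (@cvg_comp _ _ _ id (Cp_fun (h g m)) _ (nbhs y)) => //.
  exact: Cp_fun_continuous.
rewrite (proj_rel_off m (rM y))//.
under eq_cvg do rewrite (proj_rel_off m (rM _))//.
exact: cvg_cst.
Qed.

Definition rep (x : K) n (s : state n) := forall u, Cp_fun u x = phi s u.

(** A relation satisfied by all [T u] is a state with zero functional; its projection has zero
    functional too, so [T u] composed with the projection satisfies the same relation and lies in
    the range of [T]. *)
Lemma T_proj M u : model M ->
  exists w, forall y y', proj_rel M y y' -> Cp_fun (T w) y = Cp_fun (T u) y'.
Proof.
move=> MM; have /choice [r rM] : forall y, exists y', proj_rel M y y'.
  by move=> y; exact: proj_rel_exists.
have cv : continuous (fun y => Cp_fun (T u) (r y)).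
  move=> y; apply: (@continuous_comp _ _ _ r (Cp_fun (T u))).
    exact: proj_rel_continuous.
  exact: Cp_fun_continuous.
have [n y l yl|w Tw] := @range_orthogonal (mkCp cv).
  have [y' [py' y'0]] := @model_invariant M false n (y, l) MM yl.
  rewrite -[RHS](y'0 u); apply: eq_bigr => i _ /=.
  by rewrite (proj_rel_uniq (py' i) (rM _)).
by exists w => y y' py'; rewrite (proj_rel_uniq py' (rM y)) Tw.
Qed.

Definition retract_rel M x x' := exists n (s : state n) y',
  [/\ rep x s, (forall i, proj_rel M (s.1 i) (y' i)) & rep x' (y', s.2)].

Lemma retract_rel_exists M x : model M -> exists x', retract_rel M x x'.
Proof.
move=> MM; have [n [y [l yl]]] := eval_span x.
have [|y' [py' [x' x'y']]] := @model_invariant M true n (y, l) MM.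
  by exists x => u; rewrite yl.
by exists x', n, (y, l), y'; split=> // u; rewrite x'x'y'.
Qed.

(** Independence of the representing state: for [w] given by [T_proj], both projected states have
    the value [w x] at [u]. *)
Lemma retract_rel_rep M x x' n (s : state n) y' : model M ->
  retract_rel M x x' -> rep x s -> (forall i, proj_rel M (s.1 i) (y' i)) ->
  rep x' (y', s.2).
Proof.
move=> MM [n1 [s1 [y1 [xs1 py1 x'y1]]]] xs py' u.
have [w wP] := T_proj u MM.
have wr n2 (s2 : state n2) y2 : rep x s2 ->
    (forall i, proj_rel M (s2.1 i) (y2 i)) -> Cp_fun w x = phi (y2, s2.2) u.
  move=> /(_ w) -> py2; apply: eq_bigr => i _.
  by rewrite (wP _ _ (py2 i)).
by rewrite x'y1 -(wr _ _ _ xs1 py1); exact: wr.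
Qed.

Lemma retract_rel_uniq M x x1 x2 : model M ->
  retract_rel M x x1 -> retract_rel M x x2 -> x1 = x2.
Proof.
move=> MM [n [s [y' [xs py' x1y']]]] x2P; apply: (Cp_inj (R := R) tK) => u.
by rewrite x1y' (retract_rel_rep MM x2P xs py').
Qed.

Definition retract M x := xget x [set x' | retract_rel M x x'].

Lemma retractP M x : model M -> retract_rel M x (retract M x).
Proof. by move=> MM; have := xgetPex x (retract_rel_exists x MM). Qed.

(** The function [w] of [T_proj] is [u] composed with the retraction, as any state representing [x]
    shows. *)
Lemma retract_continuous M u : model M ->
  exists w : Cp R K, forall x, Cp_fun w x = Cp_fun u (retract M x).
Proof.
move=> MM; have [w wP] := T_proj u MM; exists w => x.
have [n [s [y' [xs py' x'y']]]] := retractP x MM.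
by rewrite xs x'y'; apply: eq_bigr => i _; rewrite (wP _ _ (py' i)).
Qed.

Lemma retract_idem M x : model M -> retract M (retract M x) = retract M x.
Proof.
move=> MM; have xP := retractP x MM; have [n [s [y' [xs py' x'y']]]] := xP.
apply: (retract_rel_uniq MM (retractP _ MM)).
exists n, (y', s.2), y'; split=> // i; apply: proj_rel_self.
by have [] := py' i.
Qed.

(** The supports meet [M] only inside [N], so projecting the points of [s] to [M] already projects
    them to [N]. *)
Lemma retract_eq_sub M N x n (s : state n) : model M -> model N -> N `<=` M ->
  rep x s -> (forall i g, supp (s.1 i) g -> M g -> N g) ->
  retract M x = retract N x.
Proof.
move=> MM NN NM xs sMN; apply: (retract_rel_uniq NN _ (retractP x NN)).
have /choice [y' py'] : forall i, exists y', proj_rel M (s.1 i) y'.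
  by move=> i; exact: proj_rel_exists.
exists n, s, y'; split=> //.
  move=> i; split=> [g m /NM|g y'g]; first exact: (py' i).1.
  have Mg := (py' i).2 _ y'g; apply: (sMN i) => //.
  by have [m] := y'g; rewrite (py' i).1// => ?; exists m.
exact: (retract_rel_rep MM (retractP x MM)).
Qed.

(** * Models generated by a set *)

Inductive hull (X : set G) : set G :=
| hull_base g : X g -> hull X g
| hull_gen F g : (forall g', g' \in F -> hull X g') ->
    witness_support F g -> hull X g.

Lemma model_hull X : model (hull X).
Proof. by move=> F FX g; exact: hull_gen. Qed.

Lemma sub_hull X : X `<=` hull X.
Proof. by move=> g; exact: hull_base. Qed.

Lemma hull_min X M : model M -> X `<=` M -> hull X `<=` M.
Proof.
move=> MM XM g; elim=> [g' /XM//|F g' _ FM Fg'].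
exact: (MM F).
Qed.

Lemma hull_sub X Y : X `<=` Y -> hull X `<=` hull Y.
Proof.
by move=> XY; apply: hull_min (@model_hull _) _ => g /XY; exact: sub_hull.
Qed.

Lemma countable_witness_support F : countable (witness_support F).
Proof.
have -> : witness_support F = \bigcup_(p in [set: {b : bool * nat & code b.2}])
    \bigcup_(i in [set: 'I_(tag p).2])
    (if witness (tag p).1 F (tagged p) is Some s then supp (s.1 i) else set0).
  apply/seteqP; split=> g.
    move=> [b [n [d [s [i [ws sg]]]]]].
    exists (existT (fun b : bool * nat => code b.2) (b, n) d) => //.
    by exists i => //=; rewrite ws.
  move=> [[[b n] d] _ /= [i _]]; case e: witness => [s|//] sg.
  by exists b, n, d, s, i.
apply: bigcup_countable => [|p _]; first exact: countableP.
apply: bigcup_countable => // i _.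
by case: witness => // s; exact/finite_set_countable/h_fin.
Qed.

Lemma countable_seq (X : set G) : countable X ->
  countable [set F : seq G | forall g, g \in F -> X g].
Proof.
move=> /countable_injP [f injf]; apply/countable_injP.
exists (fun F => pickle (map f F)) => F F' /set_mem FX /set_mem F'X.
move=> /(pcan_inj pickleK).
elim: F F' FX F'X => [|a F IH] [|b F']//= FX F'X [fab /IH ->].
- by congr cons; apply: injf => //; apply/mem_set; [apply: FX|apply: F'X];
    rewrite mem_head.
- by move=> g gF; apply: FX; rewrite inE gF orbT.
- by move=> g gF; apply: F'X; rewrite inE gF orbT.
Qed.

Lemma countable_hull X : countable X -> countable (hull X).
Proof.
(* One round of closure: [true] keeps [Y], [false] adds the new supports. Countably many rounds
   reach a model, since each finite list appears at a finite round. *)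
move=> cX; pose step (Y : set G) := \bigcup_(b in [set: bool])
  if b then Y else \bigcup_(F in [set F : seq G | forall g, g \in F -> Y g])
    witness_support F.
have cY n : countable (iter n step X).
  elim: n => //= n IH; apply: bigcup_countable => // -[] _ //.
  apply: bigcup_countable => [|F _]; first exact: countable_seq.
  exact: countable_witness_support.
have stepS m n g : (m <= n)%N -> iter m step X g -> iter n step X g.
  elim: n => [|n IH]; first by rewrite leqn0 => /eqP ->.
  rewrite leq_eqVlt => /predU1P [->//|mn Xg]; exists true => //.
  exact: IH.
apply: (@sub_countable _ _ _ (\bigcup_n iter n step X)).
  apply: subset_card_le; apply: hull_min => [F FX g Fg|g Xg]; last by exists 0.
  have [n FXn] : exists n, forall g', g' \in F -> iter n step X g'.
    elim: F FX {Fg} => [|g' F IH] FX; first by exists 0.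
    have [|n Xn] := IH; first by move=> a aF; apply: FX; rewrite inE aF orbT.
    have [m _ Xm] := FX g' (mem_head _ _).
    exists (maxn m n) => a; rewrite inE => /predU1P [->|/Xn].
      by apply: stepS Xm; rewrite leq_maxl.
    by apply: stepS; rewrite leq_maxr.
  by exists n.+1 => //; exists false => //; exists F.
exact: bigcup_countable.
Qed.

(** * The point-finite separating family *)

(** The functions live on all of [K] and are point-finite there, while separation is only up to
    [retract M]; families for different [M] can thus be combined. *)
Definition NY_retract (M : set G) := exists (P : Type) (f : P -> nat -> Cp R K),
  (forall x, finite_set [set t | exists m, Cp_fun (f t m) x <> 0]) /\
  forall x x', (forall t m, Cp_fun (f t m) x = Cp_fun (f t m) x') ->
    retract M x = retract M x'.

(** Otherwise states supported in [M] would approach [s0] in all coordinates while [phi] stays [d]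
    away. Their limit is the projection of [s0], which is [s0] itself, contradicting the continuity
    of [phi]. *)
Lemma code_nbhs M (e : nat -> option G) n (s0 : state n) u (d : R) :
  (forall g, M g -> exists a, e a = Some g) ->
  supported M s0 -> 0 < d ->
  exists c : code n, has_code e s0 c /\
    forall s, supported M s -> has_code e s c -> `|phi s u - phi s0 u| < d.
Proof.
move=> eM Ms0 d0; apply: contrapT => nc.
have [E k EM|U [y' [UU UB Uy Ul py']]] := @limit_state n M
    [set s | supported M s /\ d <= `|phi s u - phi s0 u|] s0.
  have /choice [a aP] : forall p : G * nat, exists a, p \in E -> e a = Some p.1.
    move=> p; have [/EM /eM [a ea]|] := boolP (p \in E); last by exists 0.
    by exists a.
  pose qs : seq (coord_index n) := [seq (i, None) | i <- enum 'I_n] ++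
    [seq (i, Some (a p, p.2)) | i <- enum 'I_n, p <- E].
  pose c : code n :=
    (k, qs, [seq Num.floor (coord e q s0 * k.+1%:R) | q <- qs]).
  have c0 : has_code e s0 c by [].
  apply: contrapT => ns; apply: nc; exists c; split=> // s Ms cs.
  rewrite ltNge; apply/negP => ds; apply: ns; exists s; split=> //.
  - move=> i; apply: (has_code_close (q := (i, None)) cs c0).
    by rewrite /= mem_cat map_f ?mem_enum.
  - move=> i p pE.
    have := has_code_close (q := (i, Some (a p, p.2))) cs c0.
    rewrite /coord /= aP//; apply.
    by rewrite mem_cat; apply/orP; right; apply: allpairs_f; rewrite ?mem_enum.
have y's i : y' i = s0.1 i.
  by apply: proj_rel_uniq (py' i) _; apply: proj_rel_self; exact: Ms0.
have Us : phi s u @[s --> U] --> phi s0 u.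
  rewrite (_ : phi s0 u = phi (y', s0.2) u); first exact: phi_cvg.
  by apply: eq_bigr => i _; rewrite /= y's.
have /cvgr_dist_lt /(_ d d0) Ud := Us.
have [s [[_ + ]]] := filter_ex (filterI UB Ud).
by rewrite /= distrC ltNge => ->.
Qed.

(** The sets [net d] form a countable network for the image of the retraction. For each pair of them
    that some function separates, one such function is chosen and composed with the retraction. *)
Lemma countable_NY_retract M : model M -> countable M -> NY_retract M.
Proof.
move=> MM /countable_injP [f injf].
pose e k := if pselect (exists g, M g /\ f g = k) is left ex
  then Some (projT1 (cid ex)) else None.
have eM g : M g -> exists a, e a = Some g.
  move=> Mg; exists (f g); rewrite /e; case: pselect => [ex|[]]; last by exists g.
  congr Some; case: cid => g' [Mg' fg']/=.
  by apply: injf => //; exact/mem_set.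
pose net (d : {n & code n}) := [set p : K | exists s : state (tag d),
  [/\ supported M s, rep p s & has_code e s (tagged d)]].
have /choice [v vP] : forall d : {n & code n} * {n & code n},
    exists v : Cp R K,
    (exists u : Cp R K,
      forall p q, net d.1 p -> net d.2 q -> Cp_fun u p <> Cp_fun u q) ->
    forall p q, net d.1 p -> net d.2 q -> Cp_fun v p <> Cp_fun v q.
  move=> d; have [[u uP]|nu] := pselect (exists u : Cp R K,
      forall p q, net d.1 p -> net d.2 q -> Cp_fun u p <> Cp_fun u q).
    by exists u.
  by exists 0 => /nu.
have /choice [w wP] : forall u, exists w : Cp R K,
    forall x, Cp_fun w x = Cp_fun u (retract M x).
  by move=> u; exact: retract_continuous.
(* A single index carries the whole countable family, so point-finiteness is immediate. *)
exists unit, (fun=> fun m => if unpickle m is Some d then w (v d) else 0).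
split=> [x|x x' xx'].
  by apply: sub_finite_set (finite_set1 tt) => -[].
apply: (Cp_inj (R := R) tK) => u; apply: contrapT => /eqP uxx'.
(* Half the gap: values within [d] of the two ends cannot coincide. *)
pose d := `|Cp_fun u (retract M x) - Cp_fun u (retract M x')| / 2.
have d0 : 0 < d by rewrite divr_gt0// normr_gt0 subr_eq0.
have hnet z : exists c, net c (retract M z) /\
    forall p, net c p -> `|Cp_fun u p - Cp_fun u (retract M z)| < d.
  have [n [s [y' [_ py' zs]]]] := retractP z MM.
  have My' : supported M (y', s.2) by move=> i; exact: (py' i).2.
  have [c [cs cP]] := code_nbhs u eM My' d0.
  exists (existT _ n c); split; first by exists (y', s.2).
  by move=> p [s1 [Ms1 -> cs1]]; rewrite zs; exact: cP.
have [c [xc cP]] := hnet x; have [c' [xc' c'P]] := hnet x'.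
have := xx' tt (pickle (c, c')); rewrite pickleK !wP.
apply: (vP (c, c')) => //; exists u => p q /cP hp /c'P hq pq.
have : `|Cp_fun u (retract M x) - Cp_fun u (retract M x')| < d + d.
  rewrite (le_lt_trans (ler_distD (Cp_fun u p) _ _))// ltrD//.
    by rewrite distrC.
  by rewrite pq.
by rewrite /d -splitr ltxx.
Qed.

(** * Induction along a chain of models *)

Section chain.
Variable lt : G -> G -> Prop.
Hypothesis lt_trans : forall i j k, lt i j -> lt j k -> lt i k.
Hypothesis lt_total : forall i j, [\/ i = j, lt i j | lt j i].
Hypothesis lt_wf : forall P : G -> Prop,
  (forall j, (forall i, lt i j -> P i) -> P j) -> forall j, P j.

Definition below (j : G) : set G := [set i | lt i j].
Definition initial (D : set G) := forall i j, lt i j -> D j -> D i.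

Lemma initial_below j : initial (below j).
Proof. by move=> i k /lt_trans; apply. Qed.

Variable Z : set G.

(* The sets [stage j] for [j] in [D], together with [hull Z], form a chain of
   models with union [hull (D `|` Z)]. *)
Definition stage (j : G) : set G := hull (below j `|` (j |` Z)).

Lemma stage_le i j : lt i j -> stage i `<=` hull (below j `|` Z).
Proof.
move=> ij; apply: hull_sub => g [gi|[->|Zg]]; [|by left|by right].
by left; exact: lt_trans ij.
Qed.

Lemma below_stage j : hull (below j `|` Z) `<=` stage j.
Proof. by apply: hull_sub => g [?|?]; [left|right; right]. Qed.

(** The models of the chain increase, so finitely many elements that each lie in some model lie in a
    common one. Since each generation rule of [hull] has finitely many premises, the union of the
    chain is closed under it. *)
Lemma hull_chain D (E : seq G) :
  (forall g, g \in E -> hull (D `|` Z) g) ->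
  (forall g, g \in E -> hull Z g) \/
  exists2 j, D j & forall g, g \in E -> stage j g.
Proof.
pose bounded (E : seq G) := (forall g, g \in E -> hull Z g) \/
  exists2 j, D j & forall g, g \in E -> stage j g.
have Zstage j : hull Z `<=` stage j.
  by apply: hull_sub => g Zg; right; right.
have stageS i j : lt i j -> stage i `<=` stage j.
  by move=> /stage_le ij; apply: subset_trans ij (@below_stage j).
have bounded_seq F : (forall g, g \in F -> bounded [:: g]) -> bounded F.
  elim: F => [|a F IH] bF; first by left.
  have /IH {}IH : forall g, g \in F -> bounded [:: g].
    by move=> g gF; apply: bF; rewrite inE gF orbT.
  have ba := bF a (mem_head _ _).
  case: ba => [Za|[i Di ia]]; case: IH => [ZF|[j Dj jF]].
  - left=> g; rewrite inE => /predU1P [->|/ZF//]; exact: Za (mem_head _ _).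
  - right; exists j => // g; rewrite inE => /predU1P [->|/jF//].
    by apply: Zstage; exact: Za (mem_head _ _).
  - right; exists i => // g; rewrite inE => /predU1P [->|/ZF/Zstage//].
    exact: ia (mem_head _ _).
  - have {}ia := ia a (mem_head _ _); case: (lt_total i j) => [ij|ij|ji].
    + right; exists j => // g; rewrite inE => /predU1P [->|/jF//].
      by rewrite -ij.
    + right; exists j => // g; rewrite inE => /predU1P [->|/jF//].
      exact: stageS ia.
    + right; exists i => // g; rewrite inE => /predU1P [->//|/jF].
      exact: stageS.
move=> DE; apply: (bounded_seq) => g /DE {DE}.
elim=> [g' [Dg'|Zg']|F g' _ bF Fg'].
- right; exists g' => // k; rewrite inE => /eqP ->.
  by apply: sub_hull; right; left.
- by left=> k; rewrite inE => /eqP ->; exact: sub_hull.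
- have [ZF|[j Dj jF]] := bounded_seq _ bF.
    by left=> k; rewrite inE => /eqP ->; exact: hull_gen Fg'.
  by right; exists j => // k; rewrite inE => /eqP ->; exact: hull_gen Fg'.
Qed.

(** States representing [x] and [x'] have finite supports, so one model of the chain contains all
    their indices in the union; on both points the two retractions then agree. *)
Lemma retract_chain D x x' : initial D ->
  retract (hull Z) x = retract (hull Z) x' ->
  (forall j, D j -> retract (stage j) x = retract (stage j) x') ->
  retract (hull (D `|` Z)) x = retract (hull (D `|` Z)) x'.
Proof.
move=> iD eZ eD; have [n [y [l xy]]] := eval_span x.
have [n' [y' [l' xy']]] := eval_span x'.
pose A := (\bigcup_(i in [set: 'I_n]) supp (y i) `|`
  \bigcup_(i in [set: 'I_n']) supp (y' i)) `&` hull (D `|` Z).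
have /finite_seqP [E AE] : finite_set A.
  apply: finite_setIl; rewrite finite_setU; split; apply: bigcup_finite => // i _;
    exact: h_fin.
have eq_sub N : model N -> N `<=` hull (D `|` Z) ->
    (forall g, g \in E -> N g) -> retract N x = retract N x' ->
    retract (hull (D `|` Z)) x = retract (hull (D `|` Z)) x'.
  move=> MN ND EN; have mD := @model_hull (D `|` Z).
  rewrite (@retract_eq_sub _ N x n (y, l))// => [|i g gy gD]; last first.
    apply: EN; have : A g by split=> //; left; exists i.
    by rewrite AE.
  rewrite (@retract_eq_sub _ N x' n' (y', l'))// => i g gy gD.
  apply: EN; have : A g by split=> //; right; exists i.
  by rewrite AE.
have [g gE|ZE|[j Dj jE]] := @hull_chain D E.
- have : A g by rewrite AE.
  by case.
- apply: (eq_sub (hull Z)) => //; first exact: model_hull.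
  by apply: hull_sub => g; right.
- apply: (eq_sub (stage j)) => //; [exact: model_hull| |exact: eD].
  apply: hull_sub => g [gj|[->|Zg]]; [|by left|by right].
  by left; exact: iD gj Dj.
Qed.

(** The family for [hull Z] is joined with the increments from [prev j] to [stage j]. Separation is
    by induction along [lt]: agreement at earlier stages gives agreement at [prev j], and the
    increments carry it to [stage j]. *)
Lemma NY_retract_chain D : initial D -> countable Z ->
  (forall j, D j -> NY_retract (stage j)) -> NY_retract (hull (D `|` Z)).
Proof.
move=> iD cZ NYD.
have [P0 [f0 [f0fin f0sep]]] :=
  countable_NY_retract (@model_hull Z) (countable_hull cZ).
have /choice [Pf PfP] : forall j, exists Pf : {P : Type & P -> nat -> Cp R K},
    (tag Pf -> D j) /\ (D j ->
    (forall x, finite_set [set t | exists m, Cp_fun (tagged Pf t m) x <> 0]) /\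
    forall x x',
      (forall t m, Cp_fun (tagged Pf t m) x = Cp_fun (tagged Pf t m) x') ->
      retract (stage j) x = retract (stage j) x').
  move=> j; have [Dj|nDj] := pselect (D j).
    have [P [f fP]] := NYD j Dj.
    by exists (existT (fun P => P -> nat -> Cp R K) P f).
  (* Off [D] the index type is empty, so every index in the sum over all [j] has [j] in [D]. *)
  exists (existT (fun P => P -> nat -> Cp R K) void (fun=> fun=> 0)).
  by split=> // -[].
have /choice [w wP] : forall p : set G * Cp R K, exists w : Cp R K,
    model p.1 -> forall x, Cp_fun w x = Cp_fun p.2 (retract p.1 x).
  move=> [M u] /=; have [MM|nM] := pselect (model M); last by exists 0.
  by have [w wP] := retract_continuous u MM; exists w.
have wE X u x : Cp_fun (w (hull X, u)) x = Cp_fun u (retract (hull X) x).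
  by apply: wP; exact: model_hull.
pose prev j := hull (below j `|` Z).
pose f (t : P0 + {j & tag (Pf j)}) m := match t with
  | inl t => f0 t m
  | inr (existT j t) =>
      w (stage j, tagged (Pf j) t m) - w (prev j, tagged (Pf j) t m)
  end.
have fE j t m x : Cp_fun (f (inr (existT _ j t)) m) x =
    Cp_fun (tagged (Pf j) t m) (retract (stage j) x) -
    Cp_fun (tagged (Pf j) t m) (retract (prev j) x).
  by rewrite -!wE.
exists (P0 + {j & tag (Pf j)})%type, f; split=> [x|x x' xx'].
  have [n [y [l xy]]] := eval_span x.
  pose J := [set j | D j /\ retract (stage j) x <> retract (prev j) x].
  (* The retractions differ at [x] only if some index in the supports of the [y i] enters between
     [prev j] and [stage j]. *)
  have Jfin : finite_set J.
    apply: (@sub_finite_set _ _ (\bigcup_(i in [set: 'I_n])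
        \bigcup_(g in supp (y i)) [set j | stage j g /\ ~ prev j g])).
      move=> j [Dj nxj]; apply: contrapT => nj; apply: nxj.
      apply: (@retract_eq_sub _ _ _ _ (y, l)) => //; try exact: model_hull.
        exact: below_stage.
      move=> i g gy gj; apply: contrapT => ng; apply: nj.
      by exists i => //; exists g.
    apply: bigcup_finite => // i _.
    apply: bigcup_finite => [|g _]; first exact: h_fin.
    (* An index enters the chain at one [j] only: a smaller stage containing it would lie inside
       [prev j]. *)
    have [[j [jg njg]]|nj] :=
      pselect (exists j, stage j g /\ ~ prev j g); last first.
      by rewrite (_ : mkset _ = set0)// -subset0 => j jP; apply: nj; exists j.
    apply: sub_finite_set (finite_set1 j) => k [kg nkg] /=.
    by case: (lt_total k j) => // [/stage_le/(_ g kg)|/stage_le/(_ g jg)].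
  pose A j z := [set t | exists m, Cp_fun (tagged (Pf j) t m) z <> 0].
  apply: (@sub_finite_set _ _ (inl @` [set t | exists m, Cp_fun (f0 t m) x <> 0] `|`
     \bigcup_(j in J) (fun t => inr (existT _ j t)) @`
       (A j (retract (stage j) x) `|` A j (retract (prev j) x)))).
    move=> [t|[j t]] [m]; first by move=> h0; left; exists t => //; exists m.
    rewrite fE => h0; right; exists j.
      split; first exact: (PfP j).1 t.
      by move=> e; apply: h0; rewrite e subrr.
    exists t => //.
    have [e|ne] := eqVneq (Cp_fun (tagged (Pf j) t m) (retract (stage j) x)) 0.
      by right; exists m => e'; apply: h0; rewrite e e' subrr.
    by left; exists m; apply/eqP.
  rewrite finite_setU; split; first exact/finite_image/f0fin.
  apply: bigcup_finite => // j [Dj _]; apply: finite_image.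
  by have [fin _] := (PfP j).2 Dj; rewrite finite_setU; split; exact: fin.
have eZ : retract (hull Z) x = retract (hull Z) x'.
  by apply: f0sep => t m; exact: (xx' (inl t) m).
apply: (retract_chain iD eZ); elim/lt_wf => j IH Dj.
have eprev : retract (prev j) x = retract (prev j) x'.
  apply: (retract_chain (@initial_below j) eZ) => i ij; exact: IH ij (iD _ _ ij Dj).
(* The separating family is evaluated at the retracted points, which the retraction fixes. *)
rewrite -retract_idem; last exact: model_hull.
rewrite -[RHS]retract_idem; last exact: model_hull.
have [_ sep] := (PfP j).2 Dj; apply: sep => t m.
have := xx' (inr (existT _ j t)) m; rewrite !fE eprev.
exact: addIr.
Qed.

End chain.

Lemma exists_NY_separation : exists (P : Type) (f : P -> nat -> Cp R K),
  (forall x, finite_set [set t | exists m, Cp_fun (f t m) x <> 0]) /\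
  forall x x', (forall t m, Cp_fun (f t m) x = Cp_fun (f t m) x') -> x = x'.
Proof.
have [le le_wo] := wochoice.well_ordering_principle G.
have le_min (A : set G) : A !=set0 -> exists2 z, A z & forall x, A x -> le z x.
  move=> [x Ax]; have [|z [[zA zmin] _]] := le_wo (fun x => `[< A x >]).
    by exists x; apply/asboolP.
  by exists z; [exact/asboolP|move=> t At; apply: zmin; exact/asboolP].
have le_total i j : le i j \/ le j i.
  have [|z [->|->] zmin] := le_min [set i; j]; first by exists i; left.
    by left; apply: zmin; right.
  by right; apply: zmin; left.
have le_anti i j : le i j -> le j i -> i = j.
  move=> ij ji; have ii : le i i by case: (le_total i i).
  have jj : le j j by case: (le_total j j).
  (* Both [i] and [j] are least in the pair, and least elements are unique. *)
  have [|z [_ zu]] := le_wo (fun x => (x == i) || (x == j)).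
    by exists i; rewrite unfold_in eqxx.
  transitivity z; [apply/esym|]; apply: zu; split; rewrite ?unfold_in ?eqxx ?orbT//;
    by move=> x /orP[] /eqP ->.
pose lt i j := ~ le j i.
have lt_total i j : [\/ i = j, lt i j | lt j i].
  have [ij|] := pselect (le i j); last by constructor 3.
  have [ji|] := pselect (le j i); last by constructor 2.
  by constructor 1; exact: le_anti.
have lt_trans i j k : lt i j -> lt j k -> lt i k.
  move=> ij jk ki; have [|z ijk zmin] := le_min [set x | [\/ x = i, x = j | x = k]].
    by exists i; constructor.
  have zi := zmin i (Or31 _ _ erefl); have zj := zmin j (Or32 _ _ erefl).
  have zk := zmin k (Or33 _ _ erefl).
  case: ijk => e; subst z; [|exact: ij|exact: jk].
  by have ik := le_anti _ _ ki zk; subst k.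
have lt_wf (P : G -> Prop) :
    (forall j, (forall i, lt i j -> P i) -> P j) -> forall j, P j.
  move=> IH j; apply: contrapT => nPj.
  have [|z nPz zmin] := le_min [set x | ~ P x]; first by exists j.
  apply: nPz; apply: IH => i iz; apply: contrapT => /zmin; exact: iz.
(* [Z] varies in the induction because [stage i] is the hull of [below i] with [Z] and the extra
   point [i]. *)
have NYb j : forall Z, countable Z -> NY_retract (hull (below lt j `|` Z)).
  elim/lt_wf: j => j IH Z cZ.
  apply: (NY_retract_chain lt_trans lt_total lt_wf) => //.
    exact: initial_below.
  move=> i ij; apply: IH => //; rewrite -bigcup2E.
  apply: bigcup_countable => [|[|[|k]] _]; first exact: countableP.
  - exact: countable1.
  - exact: cZ.
  - exact: countable0.
have [P [f [ffin fsep]]] : NY_retract (hull (setT `|` set0)).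
  apply: (NY_retract_chain lt_trans lt_total lt_wf) => // j _.
  by apply: NYb; rewrite setU0; exact: countable1.
exists P, f; split=> // x x' /fsep.
have mT := @model_hull (setT `|` set0).
(* For the whole of [G] every point of [L] is its own projection, so the retraction is the
   identity. *)
suff hullT z : retract (hull (setT `|` set0)) z = z by rewrite !hullT.
have [n [y [l zy]]] := eval_span z.
apply: (retract_rel_uniq mT (retractP z mT)); exists n, (y, l), y; split=> // i.
by apply: proj_rel_self => g _; apply: sub_hull; left.
Qed.

End model.

(** * NY compacta and separating families *)

(** Without a finite net, the sets of points far from a finite list generate a proper filter; a
    limit [p] of a finer ultrafilter contradicts the set for the list [p]. *)
Lemma compact_finite_net (R : realType) (X : topologicalType) (M : metricType R)
    (f : X -> M) (r : R) : compact [set: X] -> continuous f -> 0 < r ->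
  exists E : seq X, forall x, exists2 z, z \in E & mdist (f z) (f x) < r.
Proof.
move=> cX cf r0; apply: contrapT => nE.
pose B (E : seq X) := [set x | forall z, z \in E -> r <= mdist (f z) (f x)].
have PF : ProperFilter (filter_from [set: seq X] B).
  apply: filter_from_proper; last first.
    move=> E _; apply: contrapT => BE; apply: nE; exists E => x.
    apply: contrapT => nx; apply: BE; exists x => z zE.
    by rewrite leNgt; apply/negP => zx; apply: nx; exists z.
  apply: filter_fromT_filter; first by exists [::].
  move=> E1 E2; exists (E1 ++ E2) => x xE.
  by split=> z zE; apply: xE; rewrite mem_cat zE ?orbT.
have [U [UU BU]] := ultraFilterLemma PF.
have [p Up] := ultra_compact_cvg id cX UU.
have pr : nbhs p (f @^-1` ball (f p) r) by apply: cf; exact: nbhsx_ballx.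
have Ur : U [set x | mdist (f p) (f x) < r].
  by have := Up _ pr; rewrite ballEmdist.
have UB : U (B [:: p]) by apply: BU; exists [:: p].
have [x [xr /(_ p (mem_head _ _))]] := filter_ex (filterI Ur UB).
by rewrite leNgt xr.
Qed.

Lemma mdist_continuous (R : realType) (M : metricType R) (c : M) :
  continuous (fun x : M => (mdist x c : R)).
Proof.
move=> x; apply/cvgrPdist_lt => e e0.
have : nbhs x (ball x e) by exact: nbhsx_ballx.
apply: filterS => y; rewrite ballEmdist /= => xy.
rewrite ltr_norml; apply/andP; split.
  rewrite ltrBrDl -ltrBrDr opprK -[ltRHS]addrC.
  by rewrite (le_lt_trans (metric_triangle y x c))// metric_sym ltrD2r.
by rewrite ltrBlDr (le_lt_trans (metric_triangle x y c))// ltrD2r.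
Qed.

(** The functions are distances to points of finite nets. A net point closer to [x] than half the
    distance from [x] to [x'] tells them apart. Subtracting the value at [a] makes the functions
    vanish at the base point. *)
Lemma metrizable_separation (R : realType) (X : topologicalType) (a : X) :
  compact [set: X] -> metrizable R X ->
  exists f : nat -> X -> R, [/\ forall m, continuous (f m), forall m, f m a = 0 &
    forall x x', (forall m, f m x = f m x') -> x = x'].
Proof.
move=> cX [M [psi [cpsi [g _ [psiK _]]]]].
have /choice [E Enet] : forall k : nat, exists E : seq X,
    forall x, exists2 z, z \in E & mdist (psi z) (psi x) < k.+1%:R^-1 :> R.
  by move=> k; apply: compact_finite_net.
pose f (p : nat * nat) x : R := mdist (psi x) (psi (nth a (E p.1) p.2)) -
  mdist (psi a) (psi (nth a (E p.1) p.2)).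
exists (fun m => if unpickle m is Some p then f p else fun=> 0); split.
- move=> m; case: unpickle => [p|] x; last exact: cvg_cst.
  apply: cvgB; last exact: cvg_cst.
  apply: (@continuous_comp _ _ _ psi (fun x => (mdist x _ : R))); first exact: cpsi.
  exact: mdist_continuous.
- by move=> m; case: unpickle => // p; rewrite /f subrr.
move=> x x' xx'; rewrite -(psiK x) -(psiK x'); congr g.
apply: contrapT => /eqP; rewrite -(@mdist_gt0 R) => d0.
have [k] := @ltr_add_invr R 0 (mdist (psi x) (psi x') / 2) (divr_gt0 d0 (ltr0n _ 2)).
rewrite add0r => kd; have [z zE zx] := Enet k x.
have := xx' (pickle (k, index z (E k))); rewrite pickleK /f /= nth_index//.
move=> /addIr zxx'; have : mdist (psi x) (psi x') < mdist (psi x) (psi x') :> R.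
  rewrite [ltRHS]splitr (le_lt_trans (metric_triangle _ (psi z) _))//.
  by rewrite (metric_sym (psi z)) -zxx' metric_sym ltrD// (lt_trans zx).
by rewrite ltxx.
Qed.

Definition countably_separated (R : realType) (X : topologicalType) (G : Type)
    (h : G -> nat -> Cp R X) :=
  (forall x, finite_set [set g | exists m, Cp_fun (h g m) x <> 0]) /\
  forall x x', (forall g m, Cp_fun (h g m) x = Cp_fun (h g m) x') -> x = x'.

(** The functions on factor [g] vanish at [a g], so they are nonzero at a point only for the
    finitely many [g] where its coordinate differs from [a g]. *)
Lemma NY_separation (R : realType) (X : topologicalType) :
  NY_compact R X -> exists (G : choiceType) (h : G -> nat -> Cp R X),
    countably_separated h.
Proof.
move=> [_ [G0 [Y0 [a0 [Y0P [A0 XA0]]]]]]; move: Y0 a0 Y0P A0 XA0.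
elim/Pchoice: G0 => G Y a YP A [psi [cpsi [psi' _ [psiK _]]]].
have exf g : exists f : nat -> Y g -> R,
    [/\ forall m, continuous (f m), forall m, f m (a g) = 0 &
    forall x x', (forall m, f m x = f m x') -> x = x'].
  by have [[cY _] mY] := YP g; exact: metrizable_separation.
pose f g := projT1 (cid (exf g)); have fP g := projT2 (cid (exf g)).
pose coord g (x : X) : Y g := set_val (set_val (psi x)) g.
have ccoord g : continuous (coord g).
  move=> x; apply: (@continuous_comp X (prod_topology Y) (Y g)
      (fun x => set_val (set_val (psi x))) (fun z => z g)).
    apply: (@continuous_comp X (sigma_product a) (prod_topology Y)
      (fun x => set_val (psi x)) set_val); last exact: initial_continuous.
    apply: (@continuous_comp X A (sigma_product a) psi set_val); first exact: cpsi.
    exact: initial_continuous.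
  exact: (@proj_continuous G Y g).
have cf g m : continuous (fun x => f g m (coord g x)).
  move=> x; apply: continuous_comp; first exact: ccoord.
  by have [cf _ _] := fP g; exact: cf.
exists G, (fun g m => mkCp (cf g m)); split=> [x|x x' xx'].
  apply: sub_finite_set (set_valP (set_val (psi x))) => g [m] /=.
  apply: contra_not => h; change (f g m (coord g x) = 0).
  by have -> : coord g x = a g by []; have [_ f0 _] := fP g; exact: f0.
rewrite -(psiK x) -(psiK x'); congr psi'.
apply: val_inj; apply: val_inj; apply: functional_extensionality_dep => g.
by have [_ _ fsep] := fP g; apply: fsep => m; exact: xx'.
Qed.

(** * The Hilbert cube as a compact metric space *)

Section Hilbert_cube.
Variable R : realType.

(* The bounds [1 / (n + 1)] make the sup metric induce the product topology. *)
Definition Hilbert_cube : Type := {f : nat -> R | forall n, `|f n| <= n.+1%:R^-1}.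

HB.instance Definition _ := gen_eqMixin Hilbert_cube.
HB.instance Definition _ := gen_choiceMixin Hilbert_cube.

Implicit Types f g l : Hilbert_cube.

Definition cube_dist f g : R := sup (range (fun n => `|sval f n - sval g n|)).

Let dist_le2 f g n : `|sval f n - sval g n| <= 2 * n.+1%:R^-1.
Proof.
rewrite (le_trans (ler_normB _ _))// mulr_natl mulr2n.
by apply: lerD; [exact: (svalP f)|exact: (svalP g)].
Qed.

Lemma cube_dist_ge f g n : `|sval f n - sval g n| <= cube_dist f g.
Proof.
apply: ub_le_sup; last by exists n.
exists 2 => _ [m _ <-]; rewrite (le_trans (dist_le2 f g m))//.
by rewrite ger_pMr// invf_le1// ler1n.
Qed.

Lemma cube_dist_le f g d : (forall n, `|sval f n - sval g n| <= d) ->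
  cube_dist f g <= d.
Proof.
move=> h; apply: ge_sup; first by exists `|sval f 0 - sval g 0|; exists 0.
by move=> _ [n _ <-].
Qed.

Lemma cube_ext f g : (forall n, sval f n = sval g n) -> f = g.
Proof.
by case: f g => f fP [g gP] /= fg; apply: eq_exist; exact/funext.
Qed.

Let cube_distxx f : cube_dist f f = 0.
Proof.
apply/eqP; rewrite eq_le cube_dist_le => [|n]; last by rewrite subrr normr0.
by rewrite (le_trans _ (cube_dist_ge f f 0)).
Qed.

Let cube_dist_eq f g : cube_dist f g = 0 -> f = g.
Proof.
move=> d0; apply: cube_ext => n; apply/eqP; rewrite -subr_eq0 -normr_le0 -d0.
exact: cube_dist_ge.
Qed.

Let cube_dist_sym f g : cube_dist f g = cube_dist g f.
Proof.
by congr sup; apply/seteqP; split=> _ [n _ <-]; exists n => //; rewrite distrC.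
Qed.

Let cube_dist_triangle g f l : cube_dist f l <= cube_dist f g + cube_dist g l.
Proof.
apply: cube_dist_le => n; rewrite (le_trans (ler_distD (sval g n) _ _))//.
by apply: lerD; exact: cube_dist_ge.
Qed.

HB.instance Definition _ := isMetric.Build R Hilbert_cube
  cube_distxx cube_dist_eq cube_dist_sym cube_dist_triangle.

Lemma cube_cvg (S : Type) (U : set_system S) (f : S -> Hilbert_cube) l :
  Filter U -> (forall n, sval (f s) n @[s --> U] --> sval l n) ->
  f s @[s --> U] --> l.
Proof.
move=> FU fl; apply/(@cvg_ballP R) => e e0.
(* From [N] on, coordinates of any two points differ by at most [2 / (N + 1) < e / 2]; only the
   first [N] need convergence. *)
have [N] := @ltr_add_invr R 0 (e / 4) (divr_gt0 e0 (ltr0n _ 4)); rewrite add0r => Ne.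
have : \forall s \near U, forall n : 'I_N, `|sval l n - sval (f s) n| < e / 2.
  apply: filter_forall => n; apply: (cvgr_dist_lt _ _ (fl n)).
  by rewrite divr_gt0.
apply: filterS => s sN; rewrite (@ballEmdist R) /=.
have e2 : e / 2 < e by rewrite ltr_pdivrMr// ltr_pMr// ltr1n.
apply: le_lt_trans e2; apply: cube_dist_le => n.
have [nN|Nn] := ltnP n N; first exact: ltW (sN (Ordinal nN)).
rewrite (le_trans (dist_le2 l (f s) n))// (_ : e / 2 = 2 * (e / 4)); last by field.
rewrite ler_pM2l// (le_trans _ (ltW Ne))// lef_pV2 ?posrE// ler_nat.
by rewrite ltnS.
Qed.

Lemma cube_eval_continuous n : continuous (fun f => sval f n).
Proof.
move=> f; apply/(@cvgrPdist_lt _ _ _ (nbhs f) (nbhs_filter f)) => e e0.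
have fe : nbhs f (ball f e) by exact: nbhsx_ballx.
apply: (@filterS _ (nbhs f) _ _ _ _ fe) => g; rewrite (@ballEmdist R) /=.
exact/le_lt_trans/cube_dist_ge.
Qed.

Lemma cube_compact : compact [set: Hilbert_cube].
Proof.
rewrite compact_ultra => U UU _.
have cvg_coord n : exists x : R, `|x| <= n.+1%:R^-1 /\ sval f n @[f --> U] --> x.
  have := @segment_compact R (- n.+1%:R^-1) n.+1%:R^-1.
  rewrite compact_ultra => /(_ _ (ultra_fmap (fun f => sval f n) UU)) [|x [/= + Ux]].
    by apply: (@filterE _ U) => f /=; have := svalP f n; rewrite in_itv /= ler_norml.
  by rewrite in_itv /= -ler_norml => x1; exists x.
have /choice [l lP] := cvg_coord.
exists (exist _ l (fun n => (lP n).1)); split=> //.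
by apply: (@cube_cvg _ U id) => n; exact: (lP n).2.
Qed.

Lemma cube_compact_space : compact_space Hilbert_cube.
Proof.
split; first exact: cube_compact.
split; [exact: (@uniform_completely_regular R)|exact: (@metric_hausdorff R)].
Qed.

Lemma cube_metrizable : metrizable R Hilbert_cube.
Proof.
exists (Hilbert_cube : metricType R); exists id.
have cid' : continuous (@id (Hilbert_cube)) by move=> x; exact: cvg_id.
by split=> //; exists id.
Qed.

End Hilbert_cube.

Lemma prod_topology_cvg (I S : Type) (Y : I -> topologicalType)
    (U : set_system S) (f : S -> prod_topology Y) (l : prod_topology Y) :
  Filter U -> (forall i, f s i @[s --> U] --> l i) -> f s @[s --> U] --> l.
Proof.
move=> FU fl; apply/cvg_sup => i A; rewrite nbhsE => -[B [[V oV VB] Bl] BA].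
have Vl : nbhs (l i) V.
  by apply: open_nbhs_nbhs; split => //; move: Bl; rewrite -VB.
have UV : U [set s | V (f s i)] := fl i _ Vl.
apply: (@filterS _ U _ _ _ _ UV) => s Vs; apply: BA.
by rewrite -VB.
Qed.

Lemma prod_topology_proj_continuous (I : Type) (Y : I -> topologicalType) i :
  continuous (fun z : prod_topology Y => z i).
Proof.
elim/Pchoice: I => I in Y i *; exact: (@proj_continuous I Y i).
Qed.

Lemma continuous_set_type (X Y : topologicalType) (A : set Y) (f : X -> A) :
  continuous (fun x => set_val (f x)) -> continuous f.
Proof. by move=> cf; exact: continuous_comp_initial. Qed.

(** * A bounded continuous injection of the real line *)

Section squash.
Variable R : realType.

Definition squash (r : R) : R := r / (1 + `|r|).

Let den_gt0 (r : R) : 0 < 1 + `|r|.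
Proof. by rewrite ltr_wpDr. Qed.

Lemma squash_norm_le1 r : `|squash r| <= 1.
Proof.
rewrite /squash normrM normfV (gtr0_norm (den_gt0 r)).
by rewrite ler_pdivrMr// mul1r lerDr.
Qed.

Lemma squash0 : squash 0 = 0. Proof. by rewrite /squash mul0r. Qed.

Lemma squash_inj : injective squash.
Proof.
(* The absolute value of [squash r] determines its denominator, hence [r]. *)
move=> r s rs; have den r' : 1 - `|squash r'| = (1 + `|r'|)^-1.
  rewrite /squash normrM normfV (gtr0_norm (den_gt0 r')).
  by field; rewrite gt_eqF.
have : (1 + `|r|)^-1 = (1 + `|s|)^-1 by rewrite -!den rs.
move=> e; move: rs; rewrite /squash -e; apply: mulIf.
by rewrite invr_neq0// gt_eqF.
Qed.

Lemma squash_continuous : continuous squash.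
Proof.
move=> r; apply: cvgM; first exact: cvg_id.
apply: cvgV; first by rewrite gt_eqF.
by apply: cvgD; [exact: cvg_cst|exact: norm_continuous].
Qed.

End squash.

(** Each countable set [f t] becomes one map into the Hilbert cube with base point 0.
    Point-finiteness places the combined map in the sigma-product, separation makes it injective,
    and compactness of [X] makes it an embedding. *)
Lemma separation_NY (R : realType) (X : topologicalType) (P : Type)
    (f : P -> nat -> Cp R X) :
  compact_space X -> countably_separated f -> NY_compact R X.
Proof.
move=> [cX tX] [ffin fsep]; split=> //.
have z0P n : `|0 : R| <= n.+1%:R^-1 by rewrite normr0.
have ziP t x n : `|squash (Cp_fun (f t n) x) / n.+1%:R| <= n.+1%:R^-1.
  rewrite normrM normfV normr_nat ler_piMl//; exact: squash_norm_le1.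
pose z0 : Hilbert_cube R := exist _ (fun=> 0) z0P.
pose zi t x : Hilbert_cube R :=
  exist _ (fun n => squash (Cp_fun (f t n) x) / n.+1%:R) (ziP t x).
have zi_eq0 t x : zi t x <> z0 -> exists m, Cp_fun (f t m) x <> 0.
  apply: contra_notP => nf; apply: cube_ext => m /=.
  suff -> : Cp_fun (f t m) x = 0 by rewrite squash0 mul0r.
  by apply: contrapT => fm; apply: nf; exists m.
have zi_cont t : continuous (zi t).
  move=> x; apply: cube_cvg => n /=; apply: cvgM; last exact: cvg_cst.
  apply: (@continuous_comp _ _ _ (Cp_fun (f t n)) (@squash R)).
    exact: Cp_fun_continuous.
  exact: squash_continuous.
exists P, (fun=> Hilbert_cube R : topologicalType), (fun=> z0); split.
  by move=> _; split; [exact: cube_compact_space|exact: cube_metrizable].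
pose J (x : X) : prod_topology (fun _ : P => Hilbert_cube R : topologicalType) :=
  fun t => zi t x.
have Jsigma x : sigma_product (fun=> z0) (J x).
  by apply: sub_finite_set (ffin x) => t; exact: zi_eq0.
pose J' (x : X) : sigma_product (fun _ : P => z0) := SigSub (mem_set (Jsigma x)).
have cJ' : continuous J'.
  apply: continuous_set_type => x; apply: prod_topology_cvg => t.
  exact: zi_cont.
exists (range J'), (to_range J'); split.
  exact: continuous_set_type.
have /choice [g gP] : forall b : range J', exists x, J' x = set_val b.
  by move=> b; have [x _ xb] := set_valP b; exists x.
have coordP (x x' : X) : J' x = J' x' -> x = x'.
  move=> xx'; apply: fsep => t n.
  have : zi t x = zi t x' by have := congr1 (fun s => set_val s t) xx'.
  move=> /(congr1 (fun s => sval s n)) /= /(mulIf _) h.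
  by apply: (@squash_inj R); apply: h; rewrite invr_neq0.
have gK : cancel g (to_range J') by move=> b; apply: val_inj; exact: gP.
exists g; last by split=> // x; apply: coordP; rewrite gP.
(* The inverse maps into the compact [X], so the closed graph criterion applies; it is checked on
   each real coordinate [q]. *)
apply: ultra_continuous => // b U z UU Ub Uz.
apply: coordP; rewrite gP; apply: val_inj; apply: functional_extensionality_dep => t.
apply: cube_ext => n.
pose q (b : range J') : R := sval (set_val (set_val b) t) n.
have cq : continuous q.
  move=> c; apply: (@continuous_comp _ _ _ (fun b : range J' => set_val b)
    (fun s => sval (set_val s t) n)); first exact: initial_continuous.
  apply: (@continuous_comp _
    (prod_topology (fun _ : P => Hilbert_cube R : topologicalType)) _
    set_val (fun s => sval (s t) n)); first exact: initial_continuous.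
  apply: (@continuous_comp
    (prod_topology (fun _ : P => Hilbert_cube R : topologicalType))
    (Hilbert_cube R) _ (fun s => s t) (fun s => sval s n)).
    exact: prod_topology_proj_continuous.
  exact: cube_eval_continuous.
have cqJ : continuous (q \o to_range J').
  by move=> x; apply: continuous_comp; [exact: continuous_set_type|exact: cq].
have q1 : q c @[c --> U] --> q b.
  by apply: (@cvg_comp _ _ _ id q _ (nbhs b)) => //; exact: cq.
have q2 : q c @[c --> U] --> q (to_range J' z).
  under eq_cvg do rewrite -[X in q X]gK.
  by apply: (@cvg_comp _ _ _ g (q \o to_range J') _ (nbhs z)) => //; exact: cqJ.
exact: cvg_lim_uniq q2 q1.
Qed.

Theorem theorem4p14 (R : realType) (K L : topologicalType)
    (hK : compact_space K) (hL : compact_space L)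
    (hT : exists T : {linear Cp R K -> Cp R L},
            closed_homeomorphic_embedding T) :
  NY_compact R L -> NY_compact R K.
Proof.
move=> /NY_separation [G [h [hfin hsep]]]; have [T embT] := hT.
have [cK tK] := hK; have [cL _] := hL.
have [P [f fP]] := exists_NY_separation cK tK cL (embedding_eval_span embT)
  (closed_range_orthogonal embT) hsep hfin.
exact: (separation_NY hK fP).
Qed.
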